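(* Let $p$ be a semi-regular odd prime, let $i$ be an odd integer with $3\le i\le p-2$, and suppose $\lambda_i=1$. If the $p$-adic $L$-function $L_p(s,\omega^{1-i})$ has no zeroes of the form $$s_0=\log_{1+p}(1+p+ap^2)=1+bp,\qquad a,b\in\mathbb{Z}_p,$$ then $L_p(1,\omega^{1-i})$ is not divisible by $p^2$.
   Context: An odd prime $p$ is called semi-regular if $p$ does not divide the class number of $\mathbb{Q}(\zeta_0+\zeta_0^{-1})$ (Vandiver's conjecture), where $\zeta_0$ is a primitive $p$-th root of unity. $\omega$ is the Teichmüller character of $(\mathbb{Z}/p)^\times$ and $L_p$ the $p$-adic $L$-function. Let $f_i(T)\in\mathbb{Z}_p[[T]]$ be the power series with $f_i((1+p)^s-1)=L_p(s,\omega^{1-i})$; the Iwasawa number $\lambda_i$ is the index of the first coefficient of $f_i$ not divisible by $p$. For $u\in 1+p\mathbb{Z}_p$, $\log_{1+p}(u)$ denotes the unique $s\in\mathbb{Z}_p$ with $(1+p)^s=u$. Divisibility is in $\mathbb{Z}_p$. *)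

(* Defs.v *)
From HB Require Import structures.
From mathcomp Require Import all_boot all_order all_algebra all_field.
From mathcomp Require Import mathcomp_extra boolp classical_sets cardinality.
From mathcomp Require Import finmap.

Set Implicit Arguments.
Unset Strict Implicit.
Unset Printing Implicit Defensive.

Import GRing.Theory.
Local Open Scope ring_scope.

(* The ring Z_p, as the inverse limit of the rings Z/p^n: an element is the
   coherent sequence of its least nonnegative residues modulo p^n (the bound
   [residue x n < p ^ n] follows from coherence). The primality proof is a
   parameter of the type so that the ring instances, which depend on it, can be
   inferred. *)
Record padic_int (p : nat) (p_pr : prime p) := PadicInt {
  residue : nat -> nat;
  residue_coherent : forall n, residue n = (residue n.+1 %% p ^ n)%N }.

HB.instance Definition _ p (p_pr : prime p) := gen_eqMixin (padic_int p_pr).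
HB.instance Definition _ p (p_pr : prime p) := gen_choiceMixin (padic_int p_pr).

Section PadicRing.
Variables (p : nat) (p_pr : prime p).
Local Notation Zp := (padic_int p_pr).
Implicit Types (x y z : Zp) (n : nat).

Lemma padicP x y : (forall n, residue x n = residue y n) -> x = y.
Proof.
case: x y => [u Hu] [v Hv] /= /funext uv; rewrite uv in Hu *.
by congr PadicInt; exact: Prop_irrelevance.
Qed.

Lemma residue_mod x n : (residue x n %% p ^ n)%N = residue x n.
Proof. by rewrite [in LHS]residue_coherent modn_mod -residue_coherent. Qed.

Lemma residueS x n : residue x n.+1 = residue x n %[mod p ^ n].
Proof. by rewrite -residue_coherent residue_mod. Qed.

Lemma residue_le x n : (residue x n <= p ^ n)%N.
Proof.
by rewrite -residue_mod ltnW // ltn_mod expn_gt0 prime_gt0.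
Qed.

Lemma dvdn_expS n : (p ^ n %| p ^ n.+1)%N.
Proof. by rewrite expnS dvdn_mull. Qed.

Fact padic_of_subproof (a : nat -> nat)
    (Ha : forall n, a n.+1 = a n %[mod p ^ n]) n :
  (a n %% p ^ n = (a n.+1 %% p ^ n.+1) %% p ^ n)%N.
Proof. by rewrite modn_dvdm ?dvdn_expS // Ha. Qed.

Definition padic_of (a : nat -> nat)
    (Ha : forall n, a n.+1 = a n %[mod p ^ n]) : Zp :=
  PadicInt p_pr (padic_of_subproof Ha).

Fact padic_nat_subproof (k : nat) n : k = k %[mod p ^ n].
Proof. by []. Qed.
Definition padic_nat (k : nat) : Zp :=
  @padic_of (fun=> k) (padic_nat_subproof k).

Fact padic_add_subproof x y n :
  (residue x n.+1 + residue y n.+1 = residue x n + residue y n %[mod p ^ n])%N.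
Proof. by rewrite -modnDm !residueS modnDm. Qed.
Definition padic_add x y : Zp := padic_of (padic_add_subproof x y).

Fact padic_mul_subproof x y n :
  (residue x n.+1 * residue y n.+1 = residue x n * residue y n %[mod p ^ n])%N.
Proof. by rewrite -modnMm !residueS modnMm. Qed.
Definition padic_mul x y : Zp := padic_of (padic_mul_subproof x y).

Fact padic_opp_subproof x n :
  (p ^ n.+1 - residue x n.+1 = p ^ n - residue x n %[mod p ^ n])%N.
Proof.
apply/eqP; rewrite -(eqn_modDr (residue x n.+1)) subnK ?residue_le //.
rewrite eq_sym -modnDmr residueS modnDmr subnK ?residue_le // modnn.
by rewrite eq_sym -/(dvdn _ _) dvdn_expS.
Qed.
Definition padic_opp x : Zp := padic_of (padic_opp_subproof x).

Fact padic_addA : associative padic_add.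
Proof. by move=> x y z; apply: padicP => n /=; rewrite modnDml modnDmr addnA. Qed.
Fact padic_addC : commutative padic_add.
Proof. by move=> x y; apply: padicP => n /=; rewrite addnC. Qed.
Fact padic_add0 : left_id (padic_nat 0) padic_add.
Proof. by move=> x; apply: padicP => n /=; rewrite mod0n residue_mod. Qed.
Fact padic_addN : left_inverse (padic_nat 0) padic_opp padic_add.
Proof.
move=> x; apply: padicP => n /=.
by rewrite modnDml subnK ?residue_le // modnn mod0n.
Qed.

HB.instance Definition _ :=
  GRing.isZmodule.Build Zp padic_addA padic_addC padic_add0 padic_addN.

Fact padic_mulA : associative padic_mul.
Proof. by move=> x y z; apply: padicP => n /=; rewrite modnMml modnMmr mulnA. Qed.
Fact padic_mulC : commutative padic_mul.
Proof. by move=> x y; apply: padicP => n /=; rewrite mulnC. Qed.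
Fact padic_mul1 : left_id (padic_nat 1) padic_mul.
Proof. by move=> x; apply: padicP => n /=; rewrite modnMml mul1n residue_mod. Qed.
Fact padic_mulDl : left_distributive padic_mul padic_add.
Proof.
by move=> x y z; apply: padicP => n /=; rewrite modnMml modnDm mulnDl.
Qed.
Fact padic_1neq0 : padic_nat 1 != padic_nat 0.
Proof.
apply/eqP => /(congr1 (fun x => residue x 1)) /=.
by rewrite mod0n modn_small // expn1 prime_gt1.
Qed.

HB.instance Definition _ := GRing.Zmodule_isComNzRing.Build Zp
  padic_mulA padic_mulC padic_mul1 padic_mulDl padic_1neq0.

Definition padic_unit : {pred Zp} := fun x => `[< exists y : Zp, y * x = 1 >].
Definition padic_inv x : Zp :=
  if pselect (exists y : Zp, y * x = 1) is left e then sval (cid e) else x.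

Fact padic_mulVx : {in padic_unit, left_inverse 1 padic_inv *%R}.
Proof.
move=> x /asboolP ux; rewrite /padic_inv; case: pselect => // e.
by case: (cid e).
Qed.
Fact padic_unitPl x y : y * x = 1 -> padic_unit x.
Proof. by move=> yx1; apply/asboolP; exists y. Qed.
Fact padic_inv_out : {in [predC padic_unit], padic_inv =1 id}.
Proof.
by move=> x /asboolP nux; rewrite /padic_inv; case: pselect.
Qed.

HB.instance Definition _ := GRing.ComNzRing_hasMulInverse.Build Zp
  padic_mulVx padic_unitPl padic_inv_out.

Lemma residue_modn x m n : (m <= n)%N -> (residue x n %% p ^ m = residue x m)%N.
Proof.
elim: n => [|n IHn]; first by rewrite leqn0 => /eqP ->; rewrite residue_mod.
rewrite leq_eqVlt => /predU1P[->|mn]; first by rewrite residue_mod.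
by rewrite -IHn // [in RHS]residue_coherent modn_dvdm // dvdn_exp2l.
Qed.

Lemma padic_neq0 x : x != 0 -> exists n, ~~ (p ^ n %| residue x n)%N.
Proof.
move=> x0; apply: contrapT => xall; move/eqP: x0; apply.
apply: padicP => n /=; rewrite mod0n -residue_mod; apply/eqP/negPn/negP => xn.
by apply: xall; exists n.
Qed.

Fact padic_integral : GRing.integral_domain_axiom Zp.
Proof.
move=> x y xy0; apply/norP => -[/padic_neq0[m xm] /padic_neq0[n yn]].
have : (p ^ (m + n) %| residue x (m + n) * residue y (m + n))%N.
  by have /(congr1 (fun z => residue z (m + n))) /= := xy0; rewrite mod0n => /eqP.
have {}xm : ~~ (p ^ m %| residue x (m + n))%N.
  apply: contra xm; rewrite /dvdn residue_modn ?leq_addr // => /eqP ->.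
  by rewrite mod0n.
have {}yn : ~~ (p ^ n %| residue y (m + n))%N.
  apply: contra yn; rewrite /dvdn residue_modn ?leq_addl // => /eqP ->.
  by rewrite mod0n.
have x0 : (0 < residue x (m + n))%N.
  by rewrite lt0n; apply: contraNneq xm => ->; rewrite dvdn0.
have y0 : (0 < residue y (m + n))%N.
  by rewrite lt0n; apply: contraNneq yn => ->; rewrite dvdn0.
rewrite pfactor_dvdn ?muln_gt0 ?x0 // lognM // leqNgt => /negP; apply.
move: xm yn; rewrite !pfactor_dvdn // -!ltnNge => xm yn.
by rewrite -addSn leq_add // ltnW.
Qed.

HB.instance Definition _ := GRing.ComUnitRing_isIntegral.Build Zp padic_integral.

End PadicRing.

Notation padic_num p_pr := {fraction (padic_int p_pr)}.

Section PadicAnalysis.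
Variables (p : nat) (p_pr : prime p).
Local Notation Zp := (padic_int p_pr).
Local Notation Qp := (padic_num p_pr).

Definition Zp_dvd (d x : Zp) : Prop := exists c : Zp, x = d * c.

(* Divisibility in Q_p by elements of Z_p, i.e., x \in d Z_p. *)
Definition Qp_dvd (d x : Qp) : Prop := exists c : Zp, x = d * tofrac c.

Definition padic_cvg (u : nat -> Zp) (l : Zp) : Prop :=
  forall N : nat, exists M : nat,
    forall n : nat, (M <= n)%N -> Zp_dvd (p%:R ^+ N) (u n - l).

Definition padic_lim (u : nat -> Zp) : Zp := xget 0 [set l | padic_cvg u l].

Definition padic_continuous_at (F : Zp -> Qp) (s : Zp) : Prop :=
  forall N : nat, exists M : nat,
    forall t : Zp, Zp_dvd (p%:R ^+ M) (t - s) -> Qp_dvd (p%:R ^+ N) (F t - F s).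

(* The value at x of the power series with coefficients f; it is meaningful
   when p divides x. *)
Definition series_eval (f : nat -> Zp) (x : Zp) : Zp :=
  padic_lim (fun n => \sum_(j < n) f j * x ^+ j).

(* u ^ s for u in 1 + p Z_p: the natural numbers [residue s n] tend to s. *)
Definition padic_pow (u s : Zp) : Zp := padic_lim (fun n => u ^+ residue s n).

(* Meaningful for u in 1 + p Z_p. *)
Definition log_1p (u : Zp) : Zp := xget 0 [set s | padic_pow (1 + p%:R) s = u].

End PadicAnalysis.

(* [:: B_0; ...; B_n], from B_0 = 1 and, for n > 0,
   \sum_(j <= n) 'C(n.+1, j) B_j = 0; thus B_1 = - 1/2. *)
Fixpoint bernoulli_seq (n : nat) : seq rat :=
  if n is m.+1 then
    let s := bernoulli_seq m in
    rcons s (- (\sum_(j < n) 'C(n.+1, j)%:R * s`_j) / n.+1%:R)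
  else [:: 1].

Definition bernoulli (n : nat) : rat := (bernoulli_seq n)`_n.

Definition bernoulli_poly (n : nat) : {poly rat} :=
  \sum_(j < n.+1) ('C(n, j)%:R * bernoulli j) *: 'X^(n - j).

Section PadicL.
Variables (p : nat) (p_pr : prime p).
Local Notation Zp := (padic_int p_pr).
Local Notation Qp := (padic_num p_pr).

(* omega(a); this is 0 when p divides a, as no such root of unity exists. *)
Definition teichmuller (a : nat) : Zp :=
  xget 0 [set z : Zp | z ^+ p.-1 = 1 /\ Zp_dvd p%:R (z - a%:R)].

(* The character omega^k as a primitive Dirichlet character: the trivial
   character has conductor 1, and so is 1 even at multiples of p. *)
Definition omega_trivial (k : int) : bool := (p.-1%:Z %| k)%Z.

Definition omega_conductor (k : int) : nat := if omega_trivial k then 1%N else p.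

Definition omega_pow (k : int) (a : nat) : Qp :=
  if omega_trivial k then 1
  else if (p %| a)%N then 0 else (tofrac (teichmuller a) : Qp) ^ k.

(* The generalized Bernoulli number B_{n, chi} of chi = omega^k, of conductor f:
   the coefficient of t^n / n! in \sum_(1 <= a <= f) chi(a) t e^(a t) / (e^(f t) - 1),
   which is f^(n-1) \sum_(1 <= a <= f) chi(a) B_n(a / f). *)
Definition gen_bernoulli (n : nat) (k : int) : Qp :=
  let f := omega_conductor k in
  f%:R ^ (n%:Z - 1) *
  \sum_(1 <= a < f.+1) omega_pow k a * ratr (bernoulli_poly n).[a%:R / f%:R].

(* The Kubota-Leopoldt interpolation property of L_p(s, chi), chi = omega^k:
   L_p(1 - n, chi) = - (1 - chi omega^(-n) (p) p^(n-1)) B_{n, chi omega^(-n)} / n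
   for n >= 1, together with continuity (except at the pole s = 1 when chi is
   trivial). For chi nontrivial this determines L, the 1 - n being dense. *)
Definition is_padic_L (k : int) (L : Zp -> Qp) : Prop :=
  (forall n : nat, (0 < n)%N ->
     L (1 - n%:R) =
       - (1 - omega_pow (k - n%:Z) p * p%:R ^+ n.-1)
         * gen_bernoulli n (k - n%:Z) / n%:R) /\
  (forall s : Zp, s != 1 \/ ~~ omega_trivial k -> padic_continuous_at L s).

Definition padic_L (k : int) : Zp -> Qp := xget (fun=> 0) [set L | is_padic_L k L].

(* The coefficients of the power series f_i in Z_p[[T]] with
   f_i((1 + p)^s - 1) = L_p(s, omega^(1 - i)). *)
Definition iwasawa_series (i : nat) : nat -> Zp :=
  xget (fun=> 0) [set f : nat -> Zp | forall s : Zp,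
    tofrac (series_eval f (padic_pow (1 + p%:R) s - 1)) = padic_L (1 - i%:Z) s].

(* 0 by convention when p divides all the coefficients. *)
Definition iwasawa_lambda (i : nat) : nat :=
  xget 0%N [set l : nat | ~ Zp_dvd p%:R (iwasawa_series i l) /\
    forall j : nat, (j < l)%N -> Zp_dvd p%:R (iwasawa_series i j)].

End PadicL.

Arguments is_padic_L [p] p_pr k L.
Arguments padic_L [p] p_pr k s.
Arguments iwasawa_series [p] p_pr i.
Arguments iwasawa_lambda [p] p_pr i.

Section ClassNumber.
Variable K : fieldExtType rat.
Local Open Scope classical_set_scope.

Definition ring_of_integers : set K := [set x | integralOver (intr : int -> K) x].

Definition is_nonzero_ideal (I : set K) : Prop :=
  [/\ I `<=` ring_of_integers,
      forall x y, I x -> I y -> I (x + y),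
      forall a x, ring_of_integers a -> I x -> I (a * x),
      I 0
    & exists2 x, I x & x != 0].

Definition ideal_equiv (I J : set K) : Prop :=
  exists a b : K, [/\ ring_of_integers a, a != 0, ring_of_integers b, b != 0
    & [set a * x | x in I] = [set b * x | x in J]].

Definition ideal_class (I : set K) : set (set K) :=
  [set J | is_nonzero_ideal J /\ ideal_equiv I J].

Definition ideal_classes : set (set (set K)) :=
  [set ideal_class I | I in is_nonzero_ideal].

Definition class_number : nat := #|` fset_set ideal_classes|%fset.

End ClassNumber.

(* The condition on p does not depend on the extension L of Q or on the
   primitive root of unity z of L. *)
Definition semi_regular (p : nat) : Prop :=
  forall (L : fieldExtType rat) (z : L), p.-primitive_root z ->
    ~~ (p %| class_number (subvs_of <<1; z + z^-1>>%AS))%N.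

(* Main.v *)
Require Import Defs.
From mathcomp Require Import all_boot all_order all_algebra.
From mathcomp Require Import boolp classical_sets ring.
Import GRing.Theory.
Local Open Scope ring_scope.

(** Write P(s) = (1 + p)^s and F(s) = f(P(s) - 1) = L_p(s, omega^(1-i)), where f
is the Iwasawa series. That lambda_i = 1 says that f_1 is a unit and p divides
f_0; so F is, up to higher order, an affine function of slope p f_1:

   F(t) - F(s) = p (t - s) (f_1 + p e)   with e in Z_p depending on s, t.

This is the product of the same kind of estimate for P, of slope p
([padic_pow_slope], where p odd is essential), and for f on pZ_p, of slope f_1
([series_eval_slope]). Suppose that p^2 divides F(1). Then G = F / p is
Z_p-valued, G(1) is divisible by p, and s - G(s) / f_1 is a contraction; its
fixed point s0 is a zero of F, and the estimate between 1 and s0 gives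
s0 = 1 + bp ([zero_of_slope]). The estimate for P between 1 and s0 then reads
P(s0) = 1 + p + p^2 b (1 + pe), so that s0 = log_{1+p}(1 + p + ap^2) with
a = b (1 + pe), because P is injective: s0 is a zero of the excluded form.

Both estimates are proved first for finite objects (natural exponents, partial
sums) and then pass to the limit because principal ideals of Z_p are closed
([Zp_dvd_closed]): that e exists means that d = p^2 (t - s), or p (t - s),
divides a certain difference, and this can be tested modulo every p^N. *)

Section PadicSlopes.
Variables (p : nat) (p_pr : prime p).
Local Notation Zp := (padic_int p_pr).
Implicit Types (x y z d w a : Zp) (u : nat -> Zp) (m n k : nat).

(** * Divisibility in Z_p *)

Lemma Zp_dvd0 d : Zp_dvd d 0.
Proof. by exists 0; rewrite mulr0. Qed.

Lemma Zp_dvd_mulr d x : Zp_dvd d (d * x).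
Proof. by exists x. Qed.

Lemma Zp_dvdD d x y : Zp_dvd d x -> Zp_dvd d y -> Zp_dvd d (x + y).
Proof. by move=> [b ->] [c ->]; exists (b + c); rewrite mulrDr. Qed.

Lemma Zp_dvdN d x : Zp_dvd d x -> Zp_dvd d (- x).
Proof. by move=> [b ->]; exists (- b); rewrite mulrN. Qed.

Lemma Zp_dvdMl d x y : Zp_dvd d y -> Zp_dvd d (x * y).
Proof. by move=> [b ->]; exists (x * b); rewrite mulrCA. Qed.

Lemma Zp_dvdBC d x y : Zp_dvd d (x - y) -> Zp_dvd d (y - x).
Proof. by move/Zp_dvdN; rewrite opprB. Qed.

Lemma Zp_dvd_sum d n (F : 'I_n -> Zp) :
  (forall j, Zp_dvd d (F j)) -> Zp_dvd d (\sum_(j < n) F j).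
Proof.
move=> dF; elim/big_ind: _ => //; [exact: Zp_dvd0 | exact: Zp_dvdD].
Qed.

Lemma Zp_dvd_exp d m n x :
  (m <= n)%N -> Zp_dvd (d ^+ n) x -> Zp_dvd (d ^+ m) x.
Proof.
move=> mn [c ->]; exists (d ^+ (n - m) * c).
by rewrite mulrA -exprD subnKC.
Qed.

Lemma residue_nat k n : residue (k%:R : Zp) n = (k %% p ^ n)%N.
Proof.
by elim: k => [|k IHk] //; rewrite mulrSr /= IHk modnDml modnDmr addn1.
Qed.

Lemma residueD x y n : residue (x + y) n = ((residue x n + residue y n) %% p ^ n)%N.
Proof. by []. Qed.

Lemma residueM_exp n x m :
  residue ((p%:R : Zp) ^+ n * x) m = (p ^ n * residue x m %% p ^ m)%N.
Proof. by rewrite -natrX [LHS]/= residue_nat modnMml. Qed.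

Fact padic_divp_subproof x n m :
  (residue x (n + m.+1) %/ p ^ n = residue x (n + m) %/ p ^ n %[mod p ^ m])%N.
Proof. by rewrite !modn_divl -!expnD (addnC m) !residue_modn // leq_add2l. Qed.

Lemma Zp_dvd_residue n x : Zp_dvd (p%:R ^+ n) x <-> residue x n = 0%N.
Proof.
split=> [[c ->]|x0]; first by rewrite residueM_exp modnMr.
exists (padic_of p_pr (padic_divp_subproof x n)).
apply: padicP => m; rewrite residueM_exp /= modnMmr mulnC divnK.
  by rewrite residue_modn // leq_addl.
by rewrite /dvdn residue_modn ?leq_addr // x0.
Qed.

Lemma Zp_dvd_residueB n x y :
  Zp_dvd (p%:R ^+ n) (x - y) <-> residue x n = residue y n.
Proof.
rewrite Zp_dvd_residue; split=> [xy0|xy /=].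
  by rewrite -[x in LHS](subrK y) residueD xy0 add0n residue_mod.
by rewrite modnDmr xy subnKC ?residue_le // modnn.
Qed.

Lemma Zp_dvd_sub_residue n x : Zp_dvd (p%:R ^+ n) (x - (residue x n)%:R).
Proof. by apply/Zp_dvd_residueB; rewrite residue_nat residue_mod. Qed.

Lemma Zp_dvd_separated z : (forall n, Zp_dvd (p%:R ^+ n) z) -> z = 0.
Proof.
by move=> z0; apply: padicP => n; rewrite (residue_nat 0) mod0n; apply/Zp_dvd_residue.
Qed.

(** * Limits *)

Lemma padic_limE u l : padic_cvg u l -> padic_lim u = l.
Proof.
move=> ul; apply: xget_unique => // l' ul'; apply/eqP; rewrite -subr_eq0.
apply/eqP/Zp_dvd_separated => N; have [M uM] := ul N; have [M' uM'] := ul' N.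
rewrite -(subrKA (u (maxn M M'))); apply: Zp_dvdD.
  by apply/Zp_dvdBC/uM'; rewrite leq_maxr.
by apply: uM; rewrite leq_maxl.
Qed.

(** Completeness, with the rate of convergence: the limit is the element whose
residue modulo p^n is that of u n. *)
Lemma padic_lim_cauchy u :
  (forall n, Zp_dvd (p%:R ^+ n) (u n.+1 - u n)) ->
  forall n, Zp_dvd (p%:R ^+ n) (padic_lim u - u n).
Proof.
move=> uS.
have coh n : residue (u n.+1) n.+1 = residue (u n) n %[mod p ^ n].
  by rewrite residueS; congr modn; apply/Zp_dvd_residueB.
have dvd_l n : Zp_dvd (p%:R ^+ n) (padic_of p_pr coh - u n).
  by apply/Zp_dvd_residueB => /=; rewrite residue_mod.
suff -> : padic_lim u = padic_of p_pr coh by [].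
apply: padic_limE => N; exists N => n Nn.
by apply: (Zp_dvd_exp _ _ _ _ Nn); apply: Zp_dvdBC.
Qed.

(** Banach's fixed point theorem; it is what produces both inverses and zeros
of functions below. *)
Lemma contraction_fixpoint (Phi : Zp -> Zp) :
  (forall x y, Zp_dvd (p%:R * (y - x)) (Phi y - Phi x)) ->
  exists s, Phi s = s.
Proof.
move=> ctr; pose u n := iter n Phi 0.
have uS n : Zp_dvd (p%:R ^+ n) (u n.+1 - u n).
  elim: n => [|n [c uc]]; first by rewrite expr0 -[_ - _]mul1r; apply: Zp_dvd_mulr.
  have [e] := ctr (u n) (u n.+1); rewrite uc => Ee.
  by exists (c * e); rewrite [LHS]Ee exprS -!mulrA.
have ul := padic_lim_cauchy _ uS; exists (padic_lim u).
apply/eqP; rewrite -subr_eq0; apply/eqP/Zp_dvd_separated => n.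
rewrite -(subrKA (u n.+1)); apply: Zp_dvdD.
  have [e ->] := ctr (u n) (padic_lim u); have [c ->] := ul n.
  by exists (p%:R * c * e); ring.
by apply/Zp_dvdBC; apply: Zp_dvd_exp (ul n.+1).
Qed.

(** * Units and closedness of ideals *)

(** The inverse of 1 + pa is the fixed point of x |-> 1 - pax. *)
Lemma unit_1pD a : 1 + p%:R * a \is a GRing.unit.
Proof.
have [|s fix_s] := contraction_fixpoint (fun x => 1 - p%:R * a * x).
  by move=> x y; exists (- a); ring.
move/(canRL (subrK _)): fix_s => one_s.
by apply/unitrPr; exists s; rewrite [RHS]one_s; ring.
Qed.

(** Bezout's identity modulo p gives a multiple of w of the form 1 + pa. *)
Lemma unitNdvd w : ~ Zp_dvd p%:R w -> w \is a GRing.unit.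
Proof.
move=> pNw; have [c wc] := Zp_dvd_sub_residue 1 w; rewrite expr1 in wc.
have r_gt0 : (0 < residue w 1)%N.
  by rewrite lt0n; apply/eqP => w0; apply: pNw; exists c; rewrite -wc w0 subr0.
move/(canRL (subrK _)): wc => wc.
have /eqP cop : coprime (residue w 1) p.
  rewrite coprime_sym prime_coprime //; apply/negP => /dvdn_leq -/(_ r_gt0).
  by rewrite leqNgt -{1}residue_mod expn1 ltn_mod prime_gt0.
case: (egcdnP p r_gt0) => km kn; rewrite cop => /(congr1 (fun k => k%:R : Zp)).
rewrite natrD !natrM => kE _.
suff : km%:R * w \is a GRing.unit by rewrite unitrM => /andP[].
have -> : km%:R * w = 1 + p%:R * (kn%:R + km%:R * c) by rewrite wc mulrDr kE; ring.
exact: unit_1pD.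
Qed.

Lemma unit_dvd w x : w \is a GRing.unit -> Zp_dvd w x.
Proof. by move=> uw; exists (w^-1 * x); rewrite mulVKr. Qed.

Lemma pNdvd_unit w : w \is a GRing.unit -> ~ Zp_dvd p%:R w.
Proof.
move=> uw [c wc]; have /(congr1 (fun x => residue x 1)) := mulrV uw; rewrite wc.
rewrite -mulrA -[p%:R]expr1 residueM_exp (residue_nat 1) expn1 modnMr.
by rewrite modn_small ?prime_gt1.
Qed.

Lemma unit_nat k : coprime p k -> (k%:R : Zp) \is a GRing.unit.
Proof.
rewrite prime_coprime // => pNk; apply: unitNdvd.
by rewrite -[p%:R]expr1 Zp_dvd_residue residue_nat expn1 => /eqP; apply/negP.
Qed.

Lemma natp_neq0 : (p%:R : Zp) != 0.
Proof.
apply/eqP => /(congr1 (fun x => residue x 2)).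
rewrite (residue_nat p) (residue_nat 0) mod0n modn_small => [p0|].
  by move: p_pr; rewrite p0.
by rewrite -[X in (X < _)%N]expn1 ltn_exp2l // prime_gt1.
Qed.

Lemma unit_factorization x : x != 0 ->
  exists n c, c \is a GRing.unit /\ x = p%:R ^+ n * c.
Proof.
case/padic_neq0/ex_minnP => -[|n] xn min_n; first by rewrite dvd1n in xn.
have /Zp_dvd_residue[c xc] : residue x n = 0%N.
  have : (p ^ n %| residue x n)%N by apply: contraT => /min_n; rewrite ltnn.
  by rewrite /dvdn residue_mod => /eqP.
exists n, c; split=> //; apply: unitNdvd => -[c' cc']; move/negP: xn; apply.
suff /Zp_dvd_residue -> : Zp_dvd (p%:R ^+ n.+1) x by [].
by exists c'; rewrite xc cc' exprSr mulrA.
Qed.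

(** If d = p^n w with w a unit, congruence modulo p^n alone decides
divisibility by d; if d = 0, the congruences force z = 0. *)
Lemma Zp_dvd_closed d z :
  (forall n, exists c, Zp_dvd (p%:R ^+ n) (z - d * c)) -> Zp_dvd d z.
Proof.
move=> zd; have [d0|d_neq0] := eqVneq d 0.
  suff -> : z = 0 by exact: Zp_dvd0.
  by apply: Zp_dvd_separated => n; have [c] := zd n; rewrite d0 mul0r subr0.
have [n [w [uw dE]]] := unit_factorization d d_neq0.
have [c [b zb]] := zd n; exists (c + w^-1 * b).
by rewrite mulrDr -[z](subrK (d * c)) zb addrC dE -2!mulrA mulVKr.
Qed.

(** * Powers of principal units *)

Lemma expn_1pD_mod_p a k : Zp_dvd p%:R ((1 + p%:R * a) ^+ k - 1).
Proof. by rewrite subrX1 addrC addKr -mulrA; apply: Zp_dvd_mulr. Qed.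

Lemma expn_1pD_mod_p2 a k :
  Zp_dvd (p%:R ^+ 2) ((1 + p%:R * a) ^+ k - 1 - k%:R * (p%:R * a)).
Proof.
elim: k => [|k [c IHk]]; first by exists 0; ring.
exists (c + k%:R * a ^+ 2 + p%:R * a * c).
move: IHk => /(canRL (subrK _))/(canRL (subrK _)) IHk.
by rewrite exprS -natr1 IHk; ring.
Qed.

Lemma natr_sum1_ord k : \sum_(j < k) (1 : Zp) = k%:R.
Proof. by rewrite sumr_const card_ord. Qed.

(** Stated for all a, that is, for all principal units 1 + pa, so as to be
stable under products of exponents. The factor 1 + pe says that raising to
the power k multiplies the distance to 1 by k up to a principal unit, even
when p divides k. *)
Definition exp_slope k := forall a, exists e,
  (1 + p%:R * a) ^+ k - 1 = p%:R * a * k%:R * (1 + p%:R * e).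

Lemma exp_slopeM k l : exp_slope k -> exp_slope l -> exp_slope (k * l).
Proof.
move=> Hk Hl a; have [e Ee] := Hk a.
have [e' Ee'] := Hl (a * k%:R * (1 + p%:R * e)).
exists (e + e' + p%:R * e * e').
rewrite exprM -[(1 + _) ^+ k](subrK 1) Ee natrM [_ + 1]addrC -!mulrA.
rewrite -!mulrA in Ee'; rewrite Ee'; ring.
Qed.

(** u^k - 1 = (u - 1) (1 + u + ... + u^(k-1)), where the second factor is
congruent to the unit k modulo p. *)
Lemma exp_slope_coprime k : coprime p k -> exp_slope k.
Proof.
move=> /unit_nat uk a; rewrite subrX1 addrC addKr.
have : Zp_dvd p%:R (\sum_(j < k) (1 + p%:R * a) ^+ j - k%:R).
  rewrite -(natr_sum1_ord k) -sumrB.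
  by apply: Zp_dvd_sum => j; apply: expn_1pD_mod_p.
case=> c; have [e ->] := unit_dvd _ c uk.
by move/(canRL (subrK _)) => ->; exists e; ring.
Qed.

(** Here 1 + u + ... + u^(p-1) must be computed modulo p^2: with u = 1 + pa it is
p + pa p(p-1)/2, and p divides p(p-1)/2 as p is odd. *)
Lemma exp_slope_p : odd p -> exp_slope p.
Proof.
move=> p_odd a; rewrite subrX1 addrC addKr.
have p_gt2 : (2 < p)%N by rewrite odd_prime_gt2.
have /dvdnP[q Eq] : (p %| 'C(p, 2))%N by rewrite prime_dvd_bin.
have sumj : \sum_(j < p) (j%:R * (p%:R * a)) = p%:R ^+ 2 * (q%:R * a).
  rewrite -mulr_suml -natr_sum -(big_mkord xpredT id) bin2_sum Eq natrM; ring.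
have : Zp_dvd (p%:R ^+ 2) (\sum_(j < p) (1 + p%:R * a) ^+ j - p%:R).
  rewrite -[X in _ - X]natr_sum1_ord -sumrB.
  rewrite -(subrK (\sum_(j < p) (j%:R * (p%:R * a))) (\sum_(_ < _) _)).
  rewrite {2}sumj -sumrB; apply: Zp_dvdD (Zp_dvd_mulr _ _).
  by apply: Zp_dvd_sum => j; apply: expn_1pD_mod_p2.
by case=> c Ec; exists c; rewrite -[\sum_(_ < _) _](subrK p%:R) Ec; ring.
Qed.

Lemma exp_slope_nat k : odd p -> exp_slope k.
Proof.
move=> p_odd; have [->|k_gt0] := posnP k; first by move=> a; exists 0; ring.
have [m cop_m ->] := pfactor_coprime p_pr k_gt0.
apply: exp_slopeM (exp_slope_coprime m cop_m) _.
elim: (logn p k) => [|n IHn]; first by apply: exp_slope_coprime; rewrite coprimen1.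
by rewrite expnS; apply: exp_slopeM (exp_slope_p p_odd) IHn.
Qed.

(** Factor out the smaller power, itself a principal unit. *)
Lemma pow_slope_nat m n : odd p ->
  exists e, (1 + p%:R) ^+ n - (1 + p%:R) ^+ m
            = p%:R * (n%:R - m%:R) * (1 + p%:R * e) :> Zp.
Proof.
move=> p_odd; wlog mn : m n / (m <= n)%N => [IH|].
  have [/IH//|/ltnW/IH[e Ee]] := leqP m n.
  by exists e; rewrite -opprB Ee; ring.
have [e] := exp_slope_nat (n - m) p_odd 1; have [c] := expn_1pD_mod_p 1 m.
rewrite mulr1 => Ec Ee; exists (c + e + p%:R * c * e).
move: Ec Ee => /(canRL (subrK _)) Ec /(canRL (subrK _)) Ee.
by rewrite -{1}(subnKC mn) exprD -natrB // Ee Ec; ring.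
Qed.

(** * The function s |-> (1 + p)^s *)

Lemma pow_nat_dvd m n N : odd p ->
  Zp_dvd (p%:R ^+ N) (n%:R - m%:R : Zp) ->
  Zp_dvd (p%:R ^+ N) ((1 + p%:R) ^+ n - (1 + p%:R) ^+ m : Zp).
Proof.
move=> p_odd [c Ec]; have [e ->] := pow_slope_nat m n p_odd.
by rewrite Ec; exists (p%:R * c * (1 + p%:R * e)); ring.
Qed.

Lemma padic_pow_approx x N : odd p ->
  Zp_dvd (p%:R ^+ N) (padic_pow (1 + p%:R) x - (1 + p%:R) ^+ residue x N).
Proof.
move=> p_odd; apply: (padic_lim_cauchy (fun n => (1 + p%:R) ^+ residue x n)) => n.
apply: pow_nat_dvd => //; apply/Zp_dvd_residueB.
by rewrite !residue_nat residueS.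
Qed.

Lemma padic_pow_nat k : odd p -> padic_pow (1 + p%:R) (k%:R : Zp) = (1 + p%:R) ^+ k.
Proof.
move=> p_odd; apply: padic_limE => N; exists N => n Nn.
apply: (Zp_dvd_exp _ _ _ _ Nn); apply: pow_nat_dvd => //.
by apply: Zp_dvdBC; exact: Zp_dvd_sub_residue.
Qed.

(** Modulo p^N, the points x and y may be replaced by their residues, and P(x),
P(y) by the corresponding natural powers. *)
Lemma padic_pow_slope x y : odd p ->
  exists e, padic_pow (1 + p%:R) y - padic_pow (1 + p%:R) x
            = p%:R * (y - x) * (1 + p%:R * e).
Proof.
move=> p_odd; set P := padic_pow _.
suff [e Ee] : Zp_dvd (p%:R ^+ 2 * (y - x)) (P y - P x - p%:R * (y - x)).
  by exists e; move/(canRL (subrK _)): Ee => ->; ring.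
apply: Zp_dvd_closed => N.
have [e Ee] := pow_slope_nat (residue x N) (residue y N) p_odd; exists e.
have [c Ec] := padic_pow_approx x N p_odd.
have [c' Ec'] := padic_pow_approx y N p_odd.
have [b Eb] := Zp_dvd_sub_residue N x.
have [b' Eb'] := Zp_dvd_sub_residue N y.
exists (c' - c - (p%:R + p%:R ^+ 2 * e) * (b' - b)).
rewrite -/P in Ec Ec'; move: Ee Ec Ec' => /(canRL (subrK _)) Ee.
move=> /(canRL (subrK _)) -> /(canRL (subrK _)) ->.
have rx : (residue x N)%:R = x - p%:R ^+ N * b by rewrite -Eb subKr.
have ry : (residue y N)%:R = y - p%:R ^+ N * b' by rewrite -Eb' subKr.
by rewrite Ee rx ry; ring.
Qed.

Lemma padic_pow_inj : odd p -> injective (padic_pow (1 + p%:R : Zp)).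
Proof.
move=> p_odd x y xy; have [e] := padic_pow_slope y x p_odd.
rewrite xy subrr => /esym/eqP; rewrite !mulf_eq0 (negPf natp_neq0) /=.
case/orP=> [|e0]; first by rewrite subr_eq0 => /eqP.
by have := unit_1pD e; rewrite (eqP e0) unitr0.
Qed.

Lemma log_1p_pow (s : Zp) : odd p -> log_1p (padic_pow (1 + p%:R) s) = s.
Proof. by move=> p_odd; apply: xget_unique => // t /padic_pow_inj ->. Qed.

(** * Power series *)

Lemma series_eval_approx (f : nat -> Zp) x n : Zp_dvd p%:R x ->
  Zp_dvd (p%:R ^+ n) (series_eval f x - \sum_(j < n) f j * x ^+ j).
Proof.
move=> [c xc]; apply: (padic_lim_cauchy (fun n => \sum_(j < n) f j * x ^+ j)) => m.
rewrite big_ord_recr /= addrAC subrr add0r xc exprMn; exists (f m * c ^+ m); ring.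
Qed.

(** On pZ_p every monomial of degree at least 2 has derivative divisible by p, so
that only the linear term contributes to the slope. *)
Lemma series_eval_slope (f : nat -> Zp) x y : Zp_dvd p%:R x -> Zp_dvd p%:R y ->
  exists e, series_eval f y - series_eval f x = (y - x) * (f 1%N + p%:R * e).
Proof.
move=> px py.
suff [e Ee] : Zp_dvd (p%:R * (y - x))
                (series_eval f y - series_eval f x - (y - x) * f 1%N).
  by exists e; move/(canRL (subrK _)): Ee => ->; ring.
have monomial j : exists e, f j.+2 * y ^+ j.+2 - f j.+2 * x ^+ j.+2
                            = p%:R * (y - x) * e.
  rewrite -mulrBr subrXX.
  have [c ->] : Zp_dvd p%:R (\sum_(i < j.+2) y ^+ (j.+2.-1 - i) * x ^+ i).
    apply: Zp_dvd_sum => -[[|i] lt_i] /=.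
      by rewrite subn0 expr0 mulr1 exprSr; apply: Zp_dvdMl.
    by rewrite exprSr mulrA; apply: Zp_dvdMl.
  by exists (f j.+2 * c); ring.
apply: Zp_dvd_closed => N.
have [c Ec] := series_eval_approx f x N.+2 px.
have [c' Ec'] := series_eval_approx f y N.+2 py.
have [e Ee] : Zp_dvd (p%:R * (y - x))
    (\sum_(j < N) (f j.+2 * y ^+ j.+2 - f j.+2 * x ^+ j.+2)).
  by apply: Zp_dvd_sum => j; exact: monomial.
exists e, (p%:R ^+ 2 * (c' - c)); rewrite sumrB in Ee.
have sum2 z : \sum_(j < N.+2) f j * z ^+ j
              = f 0%N + f 1%N * z + \sum_(j < N) f j.+2 * z ^+ j.+2.
  by rewrite !big_ord_recl expr0 mulr1 expr1 addrA.
rewrite !sum2 in Ec Ec'.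
move: Ec Ec' Ee => /(canRL (subrK _)) -> /(canRL (subrK _)) -> /(canRL (subrK _)) ->.
by rewrite exprS [p%:R ^+ N.+1]exprS; ring.
Qed.

(** * Zeros of functions of unit slope *)

(** The form of Hensel's lemma needed here, for functions that need not be
polynomial. *)
Lemma zero_of_slope (F : Zp -> Zp) w x : ~ Zp_dvd p%:R w ->
  (forall s t, exists e, F t - F s = p%:R * (t - s) * (w + p%:R * e)) ->
  Zp_dvd (p%:R ^+ 2) (F x) -> exists b, F (x + b * p%:R) = 0.
Proof.
move=> /unitNdvd uw slopeF [c Fx].
have /choice[G FG] s : exists g, F s = p%:R * g.
  have [e Ee] := slopeF x s; exists (p%:R * c + (s - x) * (w + p%:R * e)).
  by move/(canRL (subrK _)): Ee => ->; rewrite Fx; ring.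
have slopeG s t : exists e, G t - G s = (t - s) * (w + p%:R * e).
  have [e Ee] := slopeF s t; exists e; apply: (mulfI natp_neq0).
  by rewrite mulrBr -!FG Ee mulrA.
(* Newton's method with the approximate slope w of G = F / p. *)
have [|s fix_s] := contraction_fixpoint (fun t => t - w^-1 * G t).
  move=> s t; have [e Ee] := slopeG s t; have [d Ed] := unit_dvd _ e uw.
  exists (- d); move/(canRL (subrK _)): Ee => ->.
  transitivity (t - s - (w^-1 * w) * (t - s) * (1 + p%:R * d)).
    by rewrite Ed; ring.
  by rewrite mulVr //; ring.
have Gs : G s = 0.
  apply: (mulrI (x := w^-1)); first by rewrite unitrV.
  rewrite mulr0; move/(canRL (subrK _))/esym/(canRL (addKr _)): fix_s => ->.
  by rewrite addrC subrr.
have [e Ee] := slopeG x s.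
have Gx : G x = p%:R * c by apply: (mulfI natp_neq0); rewrite -FG Fx; ring.
have ue : w + p%:R * e \is a GRing.unit.
  apply: unitNdvd => -[d Ed]; apply: (pNdvd_unit w uw); exists (d - e).
  by rewrite mulrBr -Ed addrK.
have [b Eb] := unit_dvd _ c ue; exists (- b).
suff -> : x + - b * p%:R = s by rewrite FG Gs mulr0.
apply: (mulIr ue); rewrite -[s in RHS](subrK x) [RHS]mulrDl -Ee Gs Gx Eb; ring.
Qed.

End PadicSlopes.

(** * The p-adic L-function *)

Theorem theorem8p6 (p : nat) (p_pr : prime p) (p_odd : odd p)
  (p_semi_regular : semi_regular p)
  (i : nat) (i_odd : odd i) (i_bounds : (3 <= i <= p - 2)%N)
  (lambda_i : iwasawa_lambda p_pr i = 1%N)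
  (no_zero : ~ exists s0 a b : padic_int p_pr,
     [/\ s0 = log_1p (1 + p%:R + a * p%:R ^+ 2),
         s0 = 1 + b * p%:R
       & padic_L p_pr (1 - i%:Z) s0 = 0]) :
  ~ Qp_dvd (p%:R ^+ 2) (padic_L p_pr (1 - i%:Z) 1).
Proof.
set f := iwasawa_series p_pr i; set P := padic_pow (1 + p%:R : padic_int p_pr).
(* The value 1 is not the default 0 of the lambda invariant, so it meets its
   definition. *)
have pNf1 : ~ Zp_dvd p%:R (f 1%N).
  move: lambda_i; rewrite /iwasawa_lambda; case: xgetP => // l -> [pNl _] l1.
  by rewrite -l1.
(* The default series 0 has no coefficient prime to p, so f is a genuine
   interpolating series. *)
have f_interpolates s : tofrac (series_eval f (P s - 1)) = padic_L p_pr (1 - i%:Z) s.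
  move: pNf1; rewrite /f /iwasawa_series; case: xgetP => [g -> //|_ []].
  exact: Zp_dvd0.
have P0 : P 0 = 1 by rewrite -[0]/(0%:R) /P padic_pow_nat.
have P1 : P 1 = 1 + p%:R by rewrite -[1]/(1%:R) /P padic_pow_nat.
have slopeP s t : exists e, P t - P s = p%:R * (t - s) * (1 + p%:R * e).
  exact: padic_pow_slope.
have pP s : Zp_dvd p%:R (P s - 1).
  by have [e] := slopeP 0 s; rewrite P0 => ->; rewrite -mulrA; apply: Zp_dvd_mulr.
have slopeF s t : exists e, series_eval f (P t - 1) - series_eval f (P s - 1)
                            = p%:R * (t - s) * (f 1%N + p%:R * e).
  have [e Ee] := slopeP s t.
  have [e' ->] := series_eval_slope p p_pr f _ _ (pP s) (pP t).
  exists (e' + e * f 1%N + p%:R * e * e').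
  by move/(canRL (subrK _)): Ee => ->; ring.
move=> [c]; rewrite -f_interpolates -(rmorph_nat (@tofrac _)) -rmorphXn -rmorphM.
move=> /eqP; rewrite tofrac_eq => /eqP Ec.
have [|b Fb] := zero_of_slope p p_pr _ (f 1%N) 1 pNf1 slopeF.
  by exists c.
have [e Ee] := slopeP 1 (1 + b * p%:R).
apply: no_zero; exists (1 + b * p%:R), (b * (1 + p%:R * e)), b; split=> //.
  rewrite -[LHS]log_1p_pow // -/P; congr log_1p.
  by move/(canRL (subrK _)): Ee => ->; rewrite P1; ring.
by rewrite -f_interpolates Fb rmorph0.
Qed.
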